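(* Let $\mathcal{A}$ be a finite set of propositional atoms (attributes). For any propositional knowledge base $K$ over $\mathcal{A}$, there exist an integer $m\geq 1$, vectors $\mathbf{a},\tilde{\mathbf{a}}\in\mathbb{R}^m$ and thresholds $\lambda_a\in\mathbb{R}$ (for $a\in\mathcal{A}$) such that for every $b\in\mathcal{A}$ and every set $\{a_1,\dots,a_n\}\subseteq\mathcal{A}$ of $n$ distinct attributes: $$b\in \mathrm{Lab}_{\mathrm{dot}}(\mathrm{Emb}_{\mathrm{had}}(a_1,\dots,a_n)) \iff K\models a_1\wedge\dots\wedge a_n\rightarrow b .$$
   Context: A propositional knowledge base over $\mathcal{A}$ is a set of propositional formulas over the atoms $\mathcal{A}$, and $\models$ is standard propositional entailment. Each attribute $a\in\mathcal{A}$ is assigned two vectors $\mathbf{a},\tilde{\mathbf{a}}\in\mathbb{R}^m$, which may be different, and a threshold $\lambda_a\in\mathbb{R}$. The embedding function is $\mathrm{Emb}_{\mathrm{had}}(a_1,\dots,a_n)=\mathbf{a}_1\odot\dots\odot\mathbf{a}_n$, where $\odot$ is the Hadamard (component-wise) product (for $n=0$, the empty product is the all-ones vector and the empty conjunction is $\top$). The labelling function is $\mathrm{Lab}_{\mathrm{dot}}(\mathbf{e})=\{b\in\mathcal{A}\mid \mathbf{e}\cdot\tilde{\mathbf{b}}\geq\lambda_b\}$ for $\mathbf{e}\in\mathbb{R}^m$. *)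

(* Defs.v *)
From mathcomp Require Import all_boot all_order all_algebra.
From mathcomp Require Import boolp classical_sets reals.

Set Implicit Arguments.
Unset Strict Implicit.
Unset Printing Implicit Defensive.

Import Order.TTheory GRing.Theory Num.Theory.
Local Open Scope ring_scope.

Inductive formula (A : Type) : Type :=
| Top
| Bot
| Atom of A
| Neg of formula A
| And of formula A & formula A
| Or of formula A & formula A
| Imp of formula A & formula A
| Iff of formula A & formula A.

Arguments Top {A}.
Arguments Bot {A}.

Fixpoint holds (A : Type) (v : A -> bool) (f : formula A) : bool :=
  match f with
  | Top => true
  | Bot => false
  | Atom a => v a
  | Neg g => ~~ holds v g
  | And g h => holds v g && holds v h
  | Or g h => holds v g || holds v h
  | Imp g h => holds v g ==> holds v h
  | Iff g h => holds v g == holds v h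
  end.

(* A knowledge base is an arbitrary, possibly infinite, set of formulas. *)
Definition knowledge_base (A : Type) : Type := set (formula A).

Definition entails (A : Type) (K : knowledge_base A) (f : formula A) : Prop :=
  forall v : A -> bool, (forall g, K g -> holds v g) -> holds v f.

Definition conj_atoms (A : Type) (s : seq A) : formula A :=
  \big[@And A/Top]_(a <- s) Atom a.

Definition hadamard (R : realType) (m : nat) (x y : 'rV[R]_m) : 'rV[R]_m :=
  map2_mx *%R x y.

Definition dot (R : realType) (m : nat) (x y : 'rV[R]_m) : R :=
  \sum_(i < m) x 0 i * y 0 i.

Definition emb_had (R : realType) (A : Type) (m : nat) (vec : A -> 'rV[R]_m)
    (s : seq A) : 'rV[R]_m :=
  \big[@hadamard R m/const_mx 1]_(a <- s) vec a.

Definition lab_dot (R : realType) (A : finType) (m : nat)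
    (tvec : A -> 'rV[R]_m) (lambda : A -> R) (e : 'rV[R]_m) : {set A} :=
  [set b | dot e (tvec b) >= lambda b]%SET.

(* Main.v *)
Require Import Defs.
From mathcomp Require Import all_boot all_order all_algebra.
From mathcomp Require Import boolp classical_sets reals.

(** Use one coordinate per valuation, a valuation being encoded as the set of
    atoms it makes true. Let [vec a] be the 0/1 indicator of the valuations
    satisfying [a]; Hadamard products are then indicators of conjunctions. Let
    [tvec b] be [-1] on the models of [K] refuting [b] and [0] elsewhere. The
    dot product counts, negatively, the countermodels to the entailment, so it
    reaches the threshold [0] exactly when there is none. *)

Import Order.TTheory GRing.Theory Num.Theory.
Local Open Scope ring_scope.

Lemma holds_conj_atoms (A : Type) (v : A -> bool) (s : seq A) :
  holds v (conj_atoms s) = all v s.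
Proof.
by rewrite /conj_atoms; elim: s => [|a s IHs]; rewrite (big_nil, big_cons) //= IHs.
Qed.

Lemma emb_hadE (R : realType) (A : Type) (m : nat) (vec : A -> 'rV[R]_m)
    (s : seq A) (i : 'I_m) :
  emb_had vec s 0 i = \prod_(a <- s) vec a 0 i.
Proof.
rewrite /emb_had; elim: s => [|a s IHs]; first by rewrite !big_nil mxE.
by rewrite !big_cons mxE IHs.
Qed.

Lemma prod_natr_bool (R : pzSemiRingType) (A : Type) (p : A -> bool) (s : seq A) :
  \prod_(a <- s) (p a)%:R = (all p s)%:R :> R.
Proof.
elim: s => [|a s IHs]; first by rewrite big_nil.
by rewrite big_cons IHs -natrM mulnb.
Qed.

(** As [A] is finite, each valuation is membership in some [{set A}], so entailment is tested on
    finitely many sets, which can index coordinates. *)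
Lemma entails_imp_atom (A : finType) (K : knowledge_base A) (s : seq A) (b : A) :
  entails K (Imp (conj_atoms s) (Atom b)) <->
  forall S : {set A}, (forall g, K g -> holds (fun a => a \in S) g) ->
    all (fun a => a \in S) s -> b \in S.
Proof.
split=> [Kb S KS sS | Kb v Kv].
  by have /= := Kb _ KS; rewrite holds_conj_atoms sS.
rewrite /= holds_conj_atoms; apply/implyP.
have vE : v = (fun a => a \in [set a | v a]%SET).
  by apply/funext => a; rewrite inE.
by move: Kv; rewrite vE; exact: Kb.
Qed.

Theorem proposition2 (R : realType) (A : finType) (K : knowledge_base A) :
  exists (m : nat) (vec tvec : A -> 'rV[R]_m) (lambda : A -> R),
    (1 <= m)%N /\
    forall (b : A) (s : seq A), uniq s ->
      (b \in lab_dot tvec lambda (emb_had vec s)) <->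
      entails K (Imp (conj_atoms s) (Atom b)).
Proof.
(* [K] may be infinite, so being a model is made boolean classically. *)
pose model (S : {set A}) := `[< forall g, K g -> holds (fun a => a \in S) g >].
pose M (i : 'I_#|{set A}|) : {set A} := enum_val i.
pose vec (a : A) : 'rV[R]_#|{set A}| := \row_i (a \in M i)%:R.
pose tvec (b : A) : 'rV[R]_#|{set A}| :=
  \row_i - (model (M i) && (b \notin M i))%:R.
exists #|{set A}|, vec, tvec, (fun=> 0); split.
  (* The empty set is a valuation even when [A] is empty. *)
  by apply/card_gt0P; exists finset.set0.
move=> b s _; rewrite entails_imp_atom inE.
pose counter (S : {set A}) :=
  [&& all (fun a => a \in S) s, model S & b \notin S].
have -> : dot (emb_had vec s) (tvec b) =
    - \sum_(i < #|{set A}|) (counter (M i))%:R.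
  rewrite /dot -sumrN; apply: eq_bigr => i _.
  rewrite emb_hadE !mxE mulrN; congr (- _).
  under eq_bigr do rewrite mxE.
  by rewrite prod_natr_bool -natrM mulnb.
(* A sum of naturals is at most 0 exactly when every term vanishes. *)
rewrite oppr_ge0 -natr_sum lern0 sum_nat_eq0; split.
  move=> /forallP none S /asboolP KS sS; apply: contraT => bS.
  by have := none (enum_rank S); rewrite /counter /M enum_rankK sS bS /model KS.
move=> Kb; apply/forallP => i; rewrite eqb0 /=.
by apply/and3P => -[sS /asboolP KS /negP]; apply; exact: Kb.
Qed.
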